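(* Let $\mathcal{A}_*(T,\Delta):=T\bigl[\cosh(\Delta/T)-1\bigr]$ for $T>0$, $\Delta\in\mathbb{R}$. For all $T_1,T_2>0$ and $\Delta_1,\Delta_2\in\mathbb{R}$, $$\mathcal{A}_*(T_1+T_2,\,\Delta_1+\Delta_2)\;\le\;\mathcal{A}_*(T_1,\Delta_1)+\mathcal{A}_*(T_2,\Delta_2),$$ with equality if and only if $\Delta_1/T_1=\Delta_2/T_2$. Equivalently: for $a<c$ and $x_a,x_c>0$, the unique global minimizer of $\mathcal{A}$ among kinetically admissible paths on $[a,c]$ from $x_a$ to $x_c$ is the single uniform-log-velocity path $\gamma_*(t)=\exp\bigl(\log x_a+\frac{t-a}{c-a}(\log x_c-\log x_a)\bigr)$; for any intermediate $b\in(a,c)$ and any value $y>0$ assigned at $b$, the concatenation of the uniform-log-velocity paths from $x_a$ to $y$ on $[a,b]$ and from $y$ to $x_c$ on $[b,c]$ has total action at least $\mathcal{A}[\gamma_*]$, with equality only when the two pieces have the same log-velocity.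
   Context: For $a<b$, an admissible path on $[a,b]$ is an absolutely continuous function $\gamma:[a,b]\to(0,\infty)$ (strictly positive at every point) with $\dot\gamma\in L^2([a,b])$; its log-coordinate is $\xi:=\log\gamma$ and its log-velocity is $\dot\xi$. It is kinetically admissible if $\int_a^b[\cosh(\dot\xi(t))-1]\,dt<\infty$, and then its kinetic action is $\mathcal{A}[\gamma]:=\int_a^b[\cosh(\dot\xi(t))-1]\,dt$. The uniform-log-velocity path on $[a,b]$ from $x_a>0$ to $x_b>0$ is $t\mapsto\exp\bigl(\log x_a+\frac{t-a}{b-a}(\log x_b-\log x_a)\bigr)$; its kinetic action is $\mathcal{A}_*(b-a,\log x_b-\log x_a)$. *)

(* Defs.v *)
From HB Require Import structures.
From mathcomp Require Import all_boot all_order all_algebra.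
From mathcomp Require Import all_classical all_reals all_analysis.
Set Implicit Arguments.
Unset Strict Implicit.
Unset Printing Implicit Defensive.
Import Order.TTheory GRing.Theory Num.Theory.
Import numFieldNormedType.Exports.
Local Open Scope classical_set_scope.
Local Open Scope ring_scope.

Section Paths.
Context {R : realType}.
Implicit Types (a b xa xb t T D : R) (f g : R -> R).

Definition cosh (x : R) : R := (expR x + expR (- x)) / 2.

Definition Astar T D : R := T * (cosh (D / T) - 1).

Definition abs_continuous_on a b f : Prop :=
  forall e : R, 0 < e -> exists2 d : R, 0 < d &
    forall (n : nat) (u v : 'I_n -> R),
      (forall i, [/\ a <= u i, u i < v i & v i <= b]) ->
      trivIset setT (fun i => `]u i, v i[%classic) ->
      \sum_(i < n) (v i - u i) < d ->
      \sum_(i < n) `|f (v i) - f (u i)| < e.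

(* A path on [a, b] is a function on R of which only the values on [a, b]
   matter. derive1 is the pointwise derivative, with the value 0
   where g is not derivable; for g absolutely continuous on [a, b] this happens
   on a null set only. Its values at a and b may depend on g outside [a, b],
   which affects neither Lebesgue norms nor integrals. *)
Definition admissible a b g : Prop :=
  [/\ abs_continuous_on a b g,
      forall t, a <= t <= b -> 0 < g t &
      (derive1 g \_ `[a, b]) \in Lfun (@lebesgue_measure R) 2%:E].

Definition log_coordinate g : R -> R := fun t => ln (g t).

Definition log_velocity g : R -> R := derive1 (log_coordinate g).

Definition kinetic_action a b g : \bar R :=
  (\int[@lebesgue_measure R]_(t in `[a, b]) (cosh (log_velocity g t) - 1)%:E)%E.

Definition kinetically_admissible a b g : Prop :=
  admissible a b g /\ (kinetic_action a b g < +oo)%E.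

Definition kinetic_paths a b xa xb : set (R -> R) :=
  [set g | [/\ kinetically_admissible a b g, g a = xa & g b = xb]].

Definition uniform_path a b xa xb : R -> R :=
  fun t => expR (ln xa + (t - a) / (b - a) * (ln xb - ln xa)).

Definition concat_path b g1 g2 : R -> R :=
  fun t => if t <= b then g1 t else g2 t.

End Paths.

Definition global_minimizer {R : realType} {X : Type} (F : X -> \bar R)
    (P : set X) (x : X) : Prop :=
  P x /\ forall y, P y -> (F x <= F y)%E.

(* Main.v *)
Require Import Defs.
From HB Require Import structures.
From mathcomp Require Import all_boot all_order all_algebra.
From mathcomp Require Import all_classical all_reals all_analysis.
From mathcomp Require Import measurable_realfun ring lra.
Set Implicit Arguments.
Unset Strict Implicit.
Unset Printing Implicit Defensive.
Import Order.TTheory GRing.Theory Num.Theory.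
Import numFieldNormedType.Exports.
Local Open Scope classical_set_scope.
Local Open Scope ring_scope.

(** Jensen's inequality in tangent-line form: with m the mean log-velocity,
    cosh v >= cosh m + sinh m * (v - m), with equality only for v = m.
    Integrating over [a, c], the linear term vanishes because the log-velocity
    v of an admissible path integrates to the increment of its log-coordinate.
    This last fact is the fundamental theorem of calculus for absolutely
    continuous functions: such an F is the difference of its variation V and
    V - F, both nondecreasing and absolutely continuous; their
    Lebesgue-Stieltjes measures have Radon-Nikodym densities, and Lebesgue
    differentiation identifies F' with the difference h of the densities
    almost everywhere. *)

(** * Tangent lines of the hyperbolic cosine *)

Definition sinh {R : realType} (x : R) : R := (expR x - expR (- x)) / 2.

Lemma expR_tangent_lt {R : realType} (m v : R) : v != m ->
  expR m * (1 + (v - m)) < expR v.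
Proof.
move=> vm; rewrite -[v in _ < expR v](subrK m) expRD mulrC.
by rewrite ltr_pM2r ?expR_gt0// expR_gt1Dx// subr_eq0.
Qed.

(** Half the sum of the strict tangent inequalities of [expR] at m and at -m. *)
Lemma cosh_tangent_lt {R : realType} (m v : R) : v != m ->
  cosh m + sinh m * (v - m) < cosh v.
Proof.
move=> vm; have := expR_tangent_lt vm.
have /expR_tangent_lt : - v != - m by rewrite eqr_opp.
rewrite /cosh /sinh; lra.
Qed.

Lemma cosh_tangent_le {R : realType} (m v : R) :
  cosh m + sinh m * (v - m) <= cosh v.
Proof.
have [->|/cosh_tangent_lt/ltW//] := eqVneq v m.
by rewrite subrr mulr0 addr0.
Qed.

Lemma cosh_ge1 {R : realType} (x : R) : 1 <= cosh x.
Proof.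
have := cosh_tangent_le 0 x.
rewrite /cosh /sinh oppr0 expR0; lra.
Qed.

(** The tangent inequality at m, evaluated at D / T and scaled by T: a support line of the convex
    function [Astar T]. Keeping m free allows one slope to serve several pieces, whose linear terms
    then add up. *)
Lemma Astar_tangent {R : realType} (m T D : R) : 0 < T ->
  T * (cosh m - 1) + sinh m * (D - T * m) <= Astar T D
    ?= iff (D / T == m).
Proof.
move=> T0; have TN0 : T != 0 by rewrite gt_eqF.
have -> : T * (cosh m - 1) + sinh m * (D - T * m) =
    T * (cosh m + sinh m * (D / T - m) - 1) by field.
rewrite /Astar; split; first by rewrite ler_pM2l// lerD2r cosh_tangent_le.
rewrite (inj_eq (mulfI TN0)) (inj_eq (addIr _)).
apply/eqP/eqP => [e|->]; last by rewrite subrr mulr0 addr0.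
apply/eqP; apply: contraT => /cosh_tangent_lt; rewrite -e ltxx//.
Qed.

(** Both pieces are compared with their support lines at the overall slope m. The linear terms sum
    to zero because D1 + D2 = (T1 + T2) m. Equality forces both slopes to be m, and two equal slopes
    are automatically equal to m. *)
Lemma Astar_subadditive {R : realType} (T1 T2 D1 D2 : R) : 0 < T1 -> 0 < T2 ->
  Astar (T1 + T2) (D1 + D2) <= Astar T1 D1 + Astar T2 D2
    ?= iff (D1 / T1 == D2 / T2).
Proof.
move=> T10 T20; pose m := (D1 + D2) / (T1 + T2).
have T1N0 : T1 != 0 by rewrite gt_eqF.
have T2N0 : T2 != 0 by rewrite gt_eqF.
have TN0 : T1 + T2 != 0 by rewrite gt_eqF// addr_gt0.
have := leifD (Astar_tangent m D1 T10) (Astar_tangent m D2 T20).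
set lhs := (X in X <= _ ?= iff _); have -> : lhs = Astar (T1 + T2) (D1 + D2).
  by rewrite /lhs /Astar -/m /m; field.
suff -> : (D1 / T1 == m) && (D2 / T2 == m) = (D1 / T1 == D2 / T2) by [].
apply/andP/eqP => [[/eqP-> /eqP->]//|e].
have D1E : D1 = D2 / T2 * T1 by rewrite -e divfK.
by rewrite e /m D1E; split; apply/eqP; field; rewrite T2N0 TN0.
Qed.

(** * Finite families of non-overlapping intervals *)

Section interval_families.
Context {R : realType}.
Implicit Types (s t : seq (R * R)) (f g : R -> R).

(* Degenerate intervals are allowed, so that families are stable under
   monotone maps such as truncation. *)
Definition interval_family s : bool :=
  all (fun p => p.1 <= p.2) s &&
  pairwise (fun p q => (p.2 <= q.1) || (q.2 <= p.1)) s.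

Definition total_length s : R := \sum_(p <- s) (p.2 - p.1).

Definition total_increment f s : R := \sum_(p <- s) `|f p.2 - f p.1|.

(** Absolute continuity on the whole line, with families given as lists. A function on [a, c] is
    brought to this setting by composition with [clamp a c]. *)
Definition abs_continuous f : Prop :=
  forall e : R, 0 < e -> exists2 d : R, 0 < d &
    forall s, interval_family s -> total_length s < d ->
      total_increment f s < e.

Definition map_family g s := [seq (g p.1, g p.2) | p <- s].

Lemma interval_family_map g s : {homo g : x y / x <= y} ->
  interval_family s -> interval_family (map_family g s).
Proof.
move=> ndg /andP[s1 s2]; apply/andP; split.
  by rewrite all_map; apply: sub_all s1 => p /=; exact: ndg.
rewrite pairwise_map; apply: sub_pairwise s2 => p q /= /orP[] /ndg -> //.
by rewrite orbT.
Qed.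

Lemma total_length_map g s :
  (forall x y, x <= y -> g y - g x <= y - x) ->
  interval_family s -> total_length (map_family g s) <= total_length s.
Proof.
move=> gL /andP[/allP s1 _]; rewrite /total_length big_map.
by rewrite big_seq [leRHS]big_seq; apply: ler_sum => p /s1 /gL.
Qed.

Lemma total_increment_map f g s :
  total_increment f (map_family g s) = total_increment (f \o g) s.
Proof. by rewrite /total_increment big_map. Qed.

Lemma interval_family_filter (P : pred (R * R)) s :
  interval_family s -> interval_family [seq p <- s | P p].
Proof.
move=> /andP[s1 s2]; apply/andP; split; last exact: pairwise_filter.
by rewrite all_filter; apply: sub_all s1 => p /= ->; rewrite implybT.
Qed.

Lemma filter_nondegenerate_family s : interval_family s ->
  let s' := [seq p <- s | p.1 < p.2] in
  total_length s' = total_length s /\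
  forall f, total_increment f s' = total_increment f s.
Proof.
move=> /andP[/allP s1 _] s'; split=> [|f].
  rewrite /total_length big_filter big_mkcond big_seq [RHS]big_seq.
  apply: eq_bigr => p /s1; rewrite le_eqVlt => /predU1P[->|->//].
  by rewrite ltxx subrr.
rewrite /total_increment big_filter big_mkcond big_seq [RHS]big_seq.
apply: eq_bigr => p /s1; rewrite le_eqVlt => /predU1P[->|->//].
by rewrite ltxx subrr normr0.
Qed.

(** For a <= c, the projection of the line onto [a, c]. Being monotone and 1-Lipschitz, it sends
    interval families to interval families without increasing their length. *)
Definition clamp (a c x : R) : R := Num.max a (Num.min x c).

Lemma clamp_id a c x : a <= x <= c -> clamp a c x = x.
Proof. by move=> /andP[ax xc]; rewrite /clamp (min_idPl xc) (max_idPr ax). Qed.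

Lemma clamp_itv a c x : a <= c -> a <= clamp a c x <= c.
Proof. by move=> ac; rewrite /clamp le_max lexx/= ge_max ac ge_min lexx orbT. Qed.

Lemma clamp_nd a c : {homo clamp a c : x y / x <= y}.
Proof. by move=> x y xy; apply: le_max2 => //; apply: le_min2. Qed.

Lemma clamp_contraction a c x y : x <= y -> clamp a c y - clamp a c x <= y - x.
Proof.
move=> xy; rewrite /clamp.
by case: (leP x c) => ?; case: (leP y c) => ?; case: (leP a x) => ?;
  case: (leP a y) => ?; case: (leP a c) => ?; lra.
Qed.

Lemma abs_continuous_clamp (a c : R) f : a <= c ->
  abs_continuous_on a c f -> abs_continuous (f \o clamp a c).
Proof.
move=> ac fac e /fac[d d0 H]; exists d => // s fs sd.
have fs' := interval_family_map (@clamp_nd a c) fs.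
have ls' := total_length_map (@clamp_contraction a c) fs.
rewrite -total_increment_map.
(* Clamping collapses the intervals outside [a, c] to points, whereas [abs_continuous_on] quantifies
   over nondegenerate intervals only. The collapsed ones contribute nothing to either sum. *)
have [_ <-] := filter_nondegenerate_family fs'.
rewrite -(filter_nondegenerate_family fs').1 in ls'.
set s' := [seq _ <- _ | _] in ls' *.
have /andP[/allP s'1 s'2] : interval_family s' by exact: interval_family_filter.
have s'P p : p \in s' -> [/\ a <= p.1, p.1 < p.2 & p.2 <= c].
  rewrite mem_filter => /andP[-> /mapP[q _ ->]] /=.
  by have /andP[-> _] := clamp_itv q.1 ac; have /andP[_ ->] := clamp_itv q.2 ac.
have := H (size s') (fun i => (tnth (in_tuple s') i).1)
  (fun i => (tnth (in_tuple s') i).2).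
rewrite -(big_tnth _ _ s' xpredT (fun p => p.2 - p.1)).
rewrite -(big_tnth _ _ s' xpredT (fun p => `|f p.2 - f p.1|)); apply.
- by move=> i; apply: s'P; exact: mem_tnth.
- apply/trivIsetP => /= i j _ _ ij; rewrite -subset0 => x /=.
  rewrite !in_itv/= => -[/andP[h1 h2] /andP[h3 h4]].
  wlog: i j ij h1 h2 h3 h4 / (i < j)%N => [hw|lij].
    move: (ij); rewrite neq_ltn => /orP[] lij; [exact: (hw i j)|].
    by apply: (hw j i) => //; rewrite eq_sym.
  move/(pairwiseP (0, 0)) : s'2 => /(_ i j); rewrite !inE.
  move=> /(_ (ltn_ord i) (ltn_ord j) lij).
  move: h1 h2 h3 h4; rewrite !(tnth_nth (0,0)) /= => h1 h2 h3 h4 /orP[]; lra.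
- exact: le_lt_trans sd.
Qed.

End interval_families.

(** * Variation of an absolutely continuous function *)

Section variation_of_abs_continuous.
Context {R : realType}.
Implicit Types (a b x y : R) (s t : seq (R * R)) (f : R -> R).

Local Notation TV := total_variation.
Local Notation BV := bounded_variation.

(** The bridge from variation sums along partitions to increments of interval families, to which
    absolute continuity applies. *)
Lemma partition_family a b l : itv_partition a b l ->
  let t := pairmap pair a l in
  [/\ interval_family t, total_length t = b - a,
      forall f, total_increment f t = variation a b f l &
      forall q, q \in t -> a <= q.1 /\ q.2 <= b].
Proof.
elim: l a => [a abl|x l ih a abl].
  rewrite (itv_partition_nil abl); split=> // [|f].
    by rewrite /total_length big_nil subrr.
  by rewrite /total_increment big_nil variation_nil.
have /ih[fl ll il sl] := itv_partition_cons abl.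
have ax : a <= x by case: abl => /= /andP[/ltW].
have xb : x <= b by apply: itv_partition_le (itv_partition_cons abl).
split=> /=.
- have /andP[fl1 fl2] := fl.
  apply/andP; split => /=; rewrite ?ax// fl2 andbT.
  by apply/allP => q /sl[-> _].
- move: ll; rewrite /total_length big_cons/= => ->; ring.
- move=> f; rewrite variation_zip//= big_cons/=.
  rewrite -(variation_zip _ (itv_partition_cons abl)) -il.
  by rewrite /total_increment big_cons.
- move=> q; rewrite in_cons => /predU1P[->//|/sl[xq ->]].
  by rewrite (le_trans ax).
Qed.

(** With d given by absolute continuity for e = 1, all variation sums on an interval shorter than d
    are below 1. A longer interval is cut into steps of length d / 2, and total variation is
    additive. *)
Lemma abs_continuous_bounded_variation f : abs_continuous f ->
  forall x y, x <= y -> BV x y f.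
Proof.
move=> /(_ 1 ltr01)[d d0 H].
have small x y : y - x < d -> BV x y f.
  move=> xyd; exists 1 => _ [l /partition_family[fl ll il _] <-].
  by rewrite -il ltW// H// ll.
move=> x y xy; apply/bounded_variationP => //.
have [n ] : exists n : nat, y - x <= n%:R * (d / 2).
  exists (Num.bound ((y - x) / (d / 2))).
  rewrite -ler_pdivrMr ?divr_gt0// ltW// archi_boundP//.
  by rewrite divr_ge0 ?subr_ge0 ?divr_ge0// ltW.
elim: n y xy => [y xy|n ih y xy nd].
  rewrite mul0r subr_le0 => yx; have -> : y = x by apply/eqP; rewrite eq_le yx.
  by rewrite total_variationxx.
have [h|h] := leP (y - x) (n%:R * (d / 2)); first exact: ih.
have [yx|yx] := leP (y - x) (d / 2).
  by apply/bounded_variationP => //; apply: small; lra.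
have xz : x <= y - d / 2 by lra.
have zy : y - d / 2 <= y by lra.
rewrite (total_variationD _ xz zy) fin_numD; apply/andP; split.
  by apply: ih => //; move: nd; rewrite -natr1; lra.
by apply/bounded_variationP => //; apply: small; lra.
Qed.

(** Each interval of s is replaced by the cells of a partition that almost realizes its total
    variation. The containment clause keeps cells of different intervals from overlapping as the
    induction proceeds. *)
Lemma variation_family f : abs_continuous f -> forall s, interval_family s ->
  forall e, 0 < e -> exists t,
    [/\ interval_family t, total_length t = total_length s,
        forall q, q \in t -> exists2 p, p \in s & p.1 <= q.1 /\ q.2 <= p.2 &
        \sum_(p <- s) fine (TV p.1 p.2 f) <= total_increment f t + e].
Proof.
move=> fac; elim=> [_ e e0|p s ih].
  by exists [::]; split=> //; rewrite /total_increment !big_nil add0r ltW.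
move=> /andP[/= /andP[p12 s1] /andP[/allP ps s2]] e e0.
have e20 : 0 < e / 2 by rewrite divr_gt0.
have /ih/(_ _ e20)[t [ft lt ct it]] : interval_family s by apply/andP.
have TVfin : TV p.1 p.2 f \is a fin_num.
  by apply/bounded_variationP => //; exact: abs_continuous_bounded_variation.
(* A partition l of the head interval within e / 2 of the supremum; the other half of the error is
   spent on the tail. *)
have [_ [_ [l pl <-] <-]] := ub_ereal_sup_adherent e20 TVfin.
rewrite -/(TV p.1 p.2 f) -(fineK TVfin) -EFinB lte_fin => TVl.
have [fu lu iu cu] := partition_family pl.
set u := pairmap _ _ _ in fu lu iu cu.
exists (u ++ t); split.
- move: fu ft => /andP[fu1 fu2] /andP[ft1 ft2].
  apply/andP; rewrite all_cat fu1 ft1; split=> //.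
  rewrite pairwise_cat fu2 ft2 !andbT; apply/allrelP => q q' /cu[pq qp] /ct[p' p's].
  move=> [pq' qp']; have /orP[h|h] := ps _ p's; apply/orP; [left|right].
    by rewrite (le_trans qp)// (le_trans h).
  by rewrite (le_trans qp')// (le_trans h).
- move: lu lt; rewrite /total_length big_cat big_cons/= => -> ->//.
- move=> q; rewrite mem_cat => /orP[/cu cq|/ct[p' p's cq]].
    by exists p => //; rewrite mem_head.
  by exists p' => //; rewrite in_cons p's orbT.
- move: it (iu f); rewrite /total_increment big_cat big_cons/= => it ->.
  lra.
Qed.

(** The maximum extends the variation function by 0 to the left of a, so that it is monotone on the
    whole line. *)
Definition variation_from a f x := fine (TV a (Num.max a x) f).

Lemma variation_fromB a f x y : abs_continuous f -> x <= y ->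
  variation_from a f y - variation_from a f x =
  fine (TV (Num.max a x) (Num.max a y) f).
Proof.
move=> fac xy; have xy' : Num.max a x <= Num.max a y by exact: le_max2.
have ax : a <= Num.max a x by rewrite le_max lexx.
have fin u v : u <= v -> TV u v f \is a fin_num.
  by move=> uv; apply/bounded_variationP => //; exact: abs_continuous_bounded_variation.
rewrite /variation_from (total_variationD f ax xy') fineD ?fin//; ring.
Qed.

Lemma variation_from_ge a f x y : abs_continuous f -> a <= x -> x <= y ->
  `|f y - f x| <= variation_from a f y - variation_from a f x.
Proof.
move=> fac ax xy; rewrite variation_fromB// !(max_idPr _)//; last exact: le_trans xy.
rewrite -lee_fin fineK; first exact: total_variation_ge.
by apply/bounded_variationP => //; exact: abs_continuous_bounded_variation.
Qed.

Lemma variation_from_nd a f : abs_continuous f ->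
  {homo variation_from a f : x y / x <= y}.
Proof.
move=> fac x y xy; rewrite -subr_ge0 variation_fromB// fine_ge0//.
by apply: total_variation_ge0; exact: le_max2.
Qed.

(** The increments over s are total variations over s pushed into [a, +oo[. Up to e / 2 these are
    increments of f itself over a refinement of the same length, hence another e / 2. *)
Lemma variation_from_abs_continuous a f : abs_continuous f ->
  abs_continuous (variation_from a f).
Proof.
move=> fac e e0; have e20 : 0 < e / 2 by rewrite divr_gt0.
have [d d0 H] := fac _ e20; exists d => // s fs sd.
have nd : {homo Num.max a : x y / x <= y} by move=> x y xy; exact: le_max2.
have fs' := interval_family_map nd fs.
have ls' : total_length (map_family (Num.max a) s) <= total_length s.
  apply: total_length_map => // x y xy.
  by case: (leP a x) => ?; case: (leP a y) => ?; lra.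
have [t [ft lt _ it]] := variation_family fac fs' e20.
have tot : total_increment (variation_from a f) s =
    \sum_(p <- map_family (Num.max a) s) fine (TV p.1 p.2 f).
  rewrite big_map /total_increment big_seq [RHS]big_seq.
  apply: eq_bigr => p ps; have /andP[/allP/(_ _ ps) p12 _] := fs.
  rewrite /= ger0_norm ?variation_fromB//.
  by rewrite -variation_fromB// subr_ge0 variation_from_nd.
have := H t ft; rewrite lt => /(_ (le_lt_trans ls' sd)).
rewrite tot; lra.
Qed.

Lemma abs_continuousB f g : abs_continuous f -> abs_continuous g ->
  abs_continuous (fun x => f x - g x).
Proof.
move=> fac gac e e0; have e20 : 0 < e / 2 by rewrite divr_gt0.
have [d d0 H] := fac _ e20; have [d' d'0 H'] := gac _ e20.
exists (Num.min d d'); first by rewrite lt_min d0.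
move=> s fs; rewrite lt_min => /andP[/(H _ fs) Hd /(H' _ fs) Hd'].
have : total_increment (fun x => f x - g x) s <=
    total_increment f s + total_increment g s.
  rewrite /total_increment -big_split/=; apply: ler_sum => p _.
  rewrite (_ : _ - _ - _ = f p.2 - f p.1 - (g p.2 - g p.1)); last by ring.
  exact: ler_normB.
lra.
Qed.

Lemma abs_continuous_dist f e : abs_continuous f -> 0 < e ->
  exists2 d, 0 < d & forall x y, `|y - x| < d -> `|f y - f x| < e.
Proof.
move=> fac /fac[d d0 H]; exists d => // x y.
wlog xy : x y / x <= y => [hw|].
  have [|/ltW yx] := leP x y; first exact: hw.
  by rewrite distrC [X in _ -> X < _]distrC; exact: hw.
rewrite ger0_norm ?subr_ge0// => xyd.
have := H [:: (x, y)]; rewrite /interval_family/= xy /total_length/=.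
by rewrite /total_increment !big_seq1; exact.
Qed.

Lemma abs_continuous_continuous f : abs_continuous f -> continuous f.
Proof.
move=> fac x; apply/cvgrPdist_lt => e e0.
have [d d0 H] := abs_continuous_dist fac e0.
near=> y; apply: H; near: y.
by exists d.
Unshelve. all: by end_near. Qed.

End variation_of_abs_continuous.

(** * Stieltjes measures of absolutely continuous functions *)

Section absolutely_continuous_stieltjes.
Context {R : realType}.
Local Notation leb := (@lebesgue_measure R).
Implicit Types (I U : set R).

(** Finite measure rules out unbounded intervals. The inner interval bounds the length from below by
    the Lebesgue measure of I; the outer one is closed on the right because that is where Stieltjes
    measures are explicit. *)
Lemma open_interval_endpoints I : open I -> is_interval I ->
  (leb I < +oo)%E ->
  exists u v, [/\ u <= v, `]u, v[%classic `<=` I & I `<=` `]u, v]%classic].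
Proof.
move=> oI /is_intervalP; case: (Rhull I) => l r IE Ioo.
have [->|/set0P[x Ix]] := eqVneq I set0.
  by exists 0, 0; split => //; rewrite set_itvoo0.
have := Ix; rewrite IE /= itv_boundlr.
have /= := lebesgue_measure_itv (Interval l r).
have -> : [set` Interval l r] = I by rewrite IE.
case: l r IE => [bl u|[]] [br v|[]] IE //=; last 4 first.
- by move=> _ /andP[].
- by move=> h; move: Ioo; rewrite h ltry ltxx.
- by move=> h; move: Ioo; rewrite h ltNyr ltxx.
- by move=> h; move: Ioo; rewrite h ltxx.
move=> _ /andP[ux xv]; exists u, v.
have ux' : u <= x by case: bl ux {IE}; rewrite bnd_simp// => /ltW.
have xv' : x <= v by case: br xv {IE}; rewrite bnd_simp// => /ltW.
split; first exact: le_trans xv'.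
  rewrite IE => y /=; rewrite !itv_boundlr /= => /andP[uy yv].
  apply/andP; split.
    by case: bl {ux IE}; rewrite bnd_simp//; move: uy; rewrite bnd_simp// => /ltW.
  by case: br {xv IE}; rewrite bnd_simp//; move: yv; rewrite bnd_simp// => /ltW.
move=> y Iy.
(* Openness puts y - e / 2 in I too, so u < y even if the hull of I is recorded as closed at u. *)
have [e /= e0 ye] : nbhs y I by exact: open_nbhs_nbhs.
have Iye : I (y - e / 2).
  by apply: ye => /=; rewrite opprB addrCA subrr addr0 gtr0_norm; lra.
move: Iy Iye; rewrite {1 2}IE/= !itv_boundlr => /andP[_ yv] /andP[uy _].
apply/andP; split; rewrite ?bnd_simp.
  by case: bl uy {ux IE}; rewrite bnd_simp; lra.
by case: br yv {xv IE}; rewrite bnd_simp// => /ltW.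
Qed.

Lemma stieltjes_itv_oc (G : cumulative R R) (u v : R) : u <= v ->
  lebesgue_stieltjes_measure G `]u, v]%classic = (G v - G u)%:E.
Proof.
move=> uv; rewrite /lebesgue_stieltjes_measure /measure_extension /=.
by rewrite measurable_mu_extE/= ?wlength_itv_bnd//; exact: is_ocitv.
Qed.

(** An open set is a countable disjoint union of open intervals. Finitely many of them form a family
    of length below d, so each partial sum of their Stieltjes measures is at most e, and the bound
    survives the limit. *)
Lemma abs_continuous_stieltjes_open (G : cumulative R R) (e d : R) :
  (forall s, interval_family s -> total_length s < d ->
    total_increment G s < e) ->
  forall U, open U -> (leb U < d%:E)%E ->
    (lebesgue_stieltjes_measure G U <= e%:E)%E.
Proof.
move=> H U oU Ud.
pose I := open_disjoint_itv oU.
have tI : trivIset setT I by exact: open_disjoint_itv_trivIset.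
have UE : U = \bigcup_q I q by exact: open_disjoint_itv_bigcup.
have mI k : measurable (I k) by apply: open_measurable; exact: open_disjoint_itv_open.
have mU : measurable U by exact: open_measurable.
have IU k : I k `<=` U by rewrite UE; exact: bigcup_sup.
have /(_ _)/cid-/all_sig[u] : forall k, exists u v,
    [/\ u <= v, `]u, v[%classic `<=` I k & I k `<=` `]u, v]%classic].
  move=> k; apply: open_interval_endpoints; [exact: open_disjoint_itv_open|
    exact: open_disjoint_itv_is_interval|].
  apply: (@le_lt_trans _ _ (leb U)); last by rewrite (lt_trans Ud)// ltry.
  by apply: le_measure; [by rewrite inE; exact: mI|by rewrite inE|exact: IU k].
move=> /(_ _)/cid-/all_sig[v] uv.
rewrite UE measure_bigcup//=; last by move=> k _; exact: mI.
apply: lime_le; first exact: is_cvg_nneseries.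
apply: nearW => n /=.
rewrite (eq_bigl xpredT); last by move=> k; rewrite in_setT.
(* An empty component may have received any endpoints u k = v k, and this point may lie inside
   another component; such pairs are dropped. *)
pose s := [seq (u k, v k) | k <- iota 0 n & u k < v k].
have sumE (g : R -> R -> R) : (forall x, g x x = 0) ->
    \sum_(p <- s) g p.1 p.2 = \sum_(0 <= k < n) g (u k) (v k).
  move=> g0; rewrite /s big_map big_filter /index_iota subn0 big_mkcond.
  apply: eq_bigr => k _; have [uvk _ _] := uv k.
  by move: uvk; rewrite le_eqVlt => /predU1P[->|->//]; rewrite ltxx g0.
have fs : interval_family s.
  apply/andP; split.
    by apply/allP => p /mapP[k]; rewrite mem_filter => /andP[/ltW uvk _ ->].
  rewrite pairwise_map.
  apply: (@sub_in_pairwise _ (fun k => u k < v k) ltn).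
  - move=> k l; rewrite !unfold_in/= => ukvk ulvl kl.
    rewrite !leNgt -negb_and; apply/negP => /andP[h1 h2].
    move/trivIsetP : tI => /(_ k l Logic.I Logic.I); rewrite ltn_eqF// => /(_ isT).
    (* Were the two intervals to overlap, the midpoint of their intersection would lie in two
       disjoint components. *)
    pose z := (Num.max (u k) (u l) + Num.min (v k) (v l)) / 2.
    have zk : `]u k, v k[%classic z.
      rewrite /= in_itv/= /z; apply/andP.
      by case: (leP (u k) (u l)) => ?; case: (leP (v k) (v l)) => ?; lra.
    have zl : `]u l, v l[%classic z.
      rewrite /= in_itv/= /z; apply/andP.
      by case: (leP (u k) (u l)) => ?; case: (leP (v k) (v l)) => ?; lra.
    rewrite -subset0 => /(_ z); apply; split.
      by have [_ + _] := uv k; apply.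
    by have [_ + _] := uv l; apply.
  - by apply/allP => k; rewrite mem_filter => /andP[].
  - apply: pairwise_filter.
    by rewrite -(sorted_pairwise ltn_trans) iota_ltn_sorted.
have sd : total_length s < d.
  rewrite /total_length (sumE (fun x y => y - x)); last by move=> x; rewrite subrr.
  rewrite -lte_fin (le_lt_trans _ Ud)// -sumEFin.
  apply: (@le_trans _ _ (\sum_(0 <= k < n) leb (I k))%E).
    apply: lee_sum => k _; have [uvk uvI _] := uv k.
    apply: (@le_trans _ _ (leb `]u k, v k[%classic)); last first.
      by apply: le_measure; [by rewrite inE|by rewrite inE; exact: mI|exact: uvI].
    rewrite lebesgue_measure_itv/= lte_fin.
    by case: ltP => // h; rewrite lee_fin subr_le0.
  rewrite big_mkord -measure_bigsetU//.
  apply: le_measure; [|by rewrite inE|].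
    by rewrite inE; apply: bigsetU_measurable => k _; exact: mI.
  by rewrite -bigcup_mkord; apply: bigcup_sub => k _; exact: IU.
apply: (@le_trans _ _ (total_increment G s)%:E); last by rewrite lee_fin ltW// H.
rewrite /total_increment (sumE (fun x y => `|G y - G x|)); last first.
  by move=> x; rewrite subrr normr0.
rewrite -sumEFin; apply: lee_sum => k _; have [uvk _ Iuv] := uv k.
rewrite ger0_norm; last by rewrite subr_ge0 cumulative_is_nondecreasing.
rewrite -stieltjes_itv_oc//; apply: le_measure;
  [by rewrite inE; exact: mI|by rewrite inE|exact: Iuv].
Qed.

(** By outer regularity a null set lies in an open set of Lebesgue measure below d, whose Stieltjes
    measure is at most e. *)
Lemma abs_continuous_dominates (G : cumulative R R) : abs_continuous G ->
  lebesgue_stieltjes_measure G `<< leb.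
Proof.
move=> Gac; apply/null_content_dominatesP => N mN N0.
apply/eqP; rewrite eq_le measure_ge0 andbT.
apply/lee_addgt0Pr => e e0; rewrite add0e.
have [d d0 H] := Gac _ e0.
have Noo : (leb N < +oo)%E by rewrite [X in (X < _)%E]N0.
have [U [oU NU Ud]] := lebesgue_regularity_outer mN Noo d0.
have UN : (leb U < d%:E)%E.
  rewrite -(setDUK NU) (le_lt_trans (measureU2 _ _ _))//.
    by apply: measurableD => //; exact: open_measurable.
  by rewrite [X in (X + _)%E]N0 add0e.
apply: le_trans (abs_continuous_stieltjes_open H oU UN).
apply: le_measure; [by rewrite inE| |exact: NU].
by rewrite inE; exact: open_measurable.
Qed.

End absolutely_continuous_stieltjes.

(** * The fundamental theorem of calculus *)

Section fundamental_theorem.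
Context {R : realType}.
Local Notation leb := (@lebesgue_measure R).
Implicit Types (a c x : R) (F G : R -> R).

Lemma abs_continuous_comp_clamp F a c : abs_continuous F ->
  abs_continuous (F \o clamp a c).
Proof.
move=> Fac e /Fac[d d0 H]; exists d => // s fs sd.
rewrite -total_increment_map; apply: H.
  exact: interval_family_map (@clamp_nd _ a c) fs.
exact: le_lt_trans (total_length_map (@clamp_contraction _ a c) fs) sd.
Qed.

(** The density is a Radon-Nikodym derivative of the Stieltjes measure of G. Restriction to ]a, c]
    makes this measure finite and leaves the mass of ]a, x] unchanged for x <= c. *)
Lemma nondecreasing_abs_continuous_density G a c :
  {homo G : x y / x <= y} -> abs_continuous G ->
  exists2 h : R -> R, leb.-integrable setT (EFin \o h) &
    forall x, a <= x <= c -> G x - G a = \int[leb]_(t in `]a, x]) h t.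
Proof.
move=> ndG Gac.
have Grc : right_continuous G.
  by apply: right_continuousW; exact: abs_continuous_continuous.
pose G' : cumulative R R := HB.pack G (isCumulative.Build R _ R G ndG Grc).
pose nu0 := lebesgue_stieltjes_measure G'.
have mac : measurable (`]a, c]%classic : set (measurableTypeR R)) by [].
have nuoo : (nu0 `]a, c]%classic < +oo)%E.
  have [ac|ca] := leP a c; first by rewrite /nu0 stieltjes_itv_oc// ltry.
  rewrite set_itv_ge; first by rewrite /nu0 measure0.
  by rewrite bnd_simp -leNgt ltW.
pose nu : {finite_measure set (measurableTypeR R) -> \bar R} := mfrestr mac nuoo.
have dom : nu `<< leb.
  apply/null_content_dominatesP => N mN N0.
  have /null_content_dominatesP := @abs_continuous_dominates R G' Gac.
  apply; first exact: measurableI.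
  apply/eqP; rewrite eq_le measure_ge0 andbT -N0; apply: le_measure.
  - by rewrite inE; exact: measurableI.
  - by rewrite inE.
  - exact: subIsetl.
have [h [_ hfin hint hE]] := radon_nikodym_sigma_finite dom.
exists (fine \o h).
  by apply: eq_integrable hint => // x _ /=; rewrite fineK.
move=> x /andP[ax xc].
rewrite /Rintegral; under eq_integral do rewrite /= fineK//.
have -> : (\int[leb]_(t in `]a, x]) h t)%E = nu `]a, x]%classic by rewrite hE.
rewrite /nu /= /mfrestr /mrestr setIidl; last exact: subset_itvl.
by rewrite [X in fine X](stieltjes_itv_oc G').
Qed.

Lemma abs_continuous_density F a c : a <= c -> abs_continuous F ->
  exists2 h : R -> R, leb.-integrable setT (EFin \o h) &
    forall x, a <= x <= c -> F x - F a = \int[leb]_(t in `]a, x]) h t.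
Proof.
move=> ac Fac.
have Vac := variation_from_abs_continuous a Fac.
have Vnd := variation_from_nd a Fac.
set V := variation_from a F in Vac Vnd.
(* V dominates the increments of F only to the right of a, so V - F is clamped to be nondecreasing
   on the whole line. *)
pose W := (fun x => V x - F x) \o clamp a c.
have Wac : abs_continuous W.
  by apply: abs_continuous_comp_clamp; exact: abs_continuousB.
have Wnd : {homo W : x y / x <= y}.
  move=> x y xy; rewrite /W /=.
  have /andP[ax _] := clamp_itv x ac.
  have := variation_from_ge Fac ax (clamp_nd a c xy).
  by rewrite -/V => /(le_trans (ler_norm _)); lra.
have [h1 ih1 h1E] := nondecreasing_abs_continuous_density a c Vnd Vac.
have [h2 ih2 h2E] := nondecreasing_abs_continuous_density a c Wnd Wac.
exists (fun x => h1 x - h2 x).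
  by apply: eq_integrable (integrableB _ ih1 ih2).
move=> x axc; rewrite RintegralB//; last 2 first.
  exact: integrableS ih1.
  exact: integrableS ih2.
rewrite -h1E// -h2E// /W /= !clamp_id ?lexx//; ring.
Qed.

Lemma abs_continuous_FTC F a c : a <= c -> abs_continuous F ->
  exists h : R -> R, [/\ leb.-integrable setT (EFin \o h),
    forall x, a <= x <= c -> F x - F a = \int[leb]_(t in `]a, x]) h t &
    {ae leb, forall x, a < x < c -> derivable F x 1 /\ derive1 F x = h x}].
Proof.
move=> ac /(abs_continuous_density ac)[h ih hE]; exists h; split => //.
have ihy y : leb.-integrable `]a, y] (EFin \o h) by exact: integrableS ih.
have := @FTC1 R h (BRight a) ihy (open_integrable_locally openT ih) => /=.
apply: filterS; first exact: (ae_filter_ringOfSetsType leb).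
move=> x /= + /andP[ax xc]; rewrite lte_fin ax => /(_ isT)[].
set P := fun y => Rintegral _ _ _.
(* The integral formula holds on a neighbourhood of the interior point x, so derivability and
   derivative pass from the indefinite integral P to F. *)
have PF : \forall y \near x, F a + P y = F y.
  near=> y; rewrite /P -hE; first by rewrite addrC subrK.
  apply/andP; split; apply: ltW; near: y.
    exact: lt_nbhsr.
  exact: lt_nbhsl.
move=> dP PE.
have dP' : derivable (fun y => F a + P y) x 1.
  by apply: derivableD => //.
split; first exact: near_eq_derivable PF dP'.
rewrite derive1E -(near_eq_derive _ PF) deriveD// derive_cst add0r.
by rewrite -derive1E.
Unshelve. all: by end_near. Qed.

End fundamental_theorem.

(** * Jensen's inequality *)

Section jensen.
Context {R : realType}.
Local Notation leb := (@lebesgue_measure R).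
Implicit Types (a c D : R) (h : R -> R).

Lemma continuous_cosh : continuous (@cosh R).
Proof.
move=> x; apply: cvgM; last exact: cvg_cst.
apply: cvgD; first exact: continuous_expR.
apply: (@continuous_comp _ _ _ -%R expR);
  [exact: opp_continuous|exact: continuous_expR].
Qed.

Lemma measurable_cosh : measurable_fun setT (@cosh R).
Proof. exact: continuous_measurable_fun continuous_cosh. Qed.

Lemma measurable_coshB1 A h : measurable A -> measurable_fun A h ->
  measurable_fun A (fun t => (cosh (h t) - 1)%:E).
Proof.
move=> mA mh; apply/measurable_EFinP.
apply: measurable_funB => //.
exact: (measurableT_comp measurable_cosh mh).
Qed.

Lemma lebesgue_itvoo a c : a < c -> leb `]a, c[%classic = (c - a)%:E.
Proof. by move=> ac; rewrite lebesgue_measure_itv/= lte_fin ac. Qed.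

Lemma cosh_jensen h a c D : a < c ->
  leb.-integrable `]a, c[ (EFin \o h) -> \int[leb]_(t in `]a, c[) h t = D ->
  let J := (\int[leb]_(t in `]a, c[) (cosh (h t) - 1)%:E)%E in
  ((Astar (c - a) D)%:E <= J)%E /\
  (J = (Astar (c - a) D)%:E ->
    {ae leb, forall t, a < t < c -> h t = D / (c - a)}).
Proof.
move=> ac ih hD J; set T := c - a; set m := D / T.
have T0 : 0 < T by rewrite subr_gt0.
have mI : measurable (`]a, c[%classic : set R) by [].
have lI := lebesgue_itvoo ac.
have mh : measurable_fun `]a, c[ h.
  by apply/measurable_EFinP; exact: measurable_int ih.
have mJ := measurable_coshB1 mI mh.
(* For infinite J the bound is trivial, and equality with a real number is impossible. *)
have [Joo|Joo] := eqVneq J +oo%E; first by rewrite Joo; split => //; exact: leey.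
have J0 : (0 <= J)%E by apply: integral_ge0 => t _; rewrite lee_fin subr_ge0 cosh_ge1.
have iJ : leb.-integrable `]a, c[ (fun t => (cosh (h t) - 1)%:E).
  apply/integrableP; split => //.
  under eq_integral do rewrite gee0_abs ?lee_fin ?subr_ge0 ?cosh_ge1//.
  by rewrite ltey.
have icst r : leb.-integrable `]a, c[ (EFin \o cst r : R -> \bar R).
  apply/integrableP; split; first by apply/measurable_EFinP; exact: measurable_cst.
  by rewrite /= integral_cst//= [X in (_ * X)%E]lI ltry.
have iZ : leb.-integrable `]a, c[ (fun t => (sinh m)%:E * (EFin \o h) t)%E.
  exact: integrableZl.
(* The tangent line of cosh - 1 at m, evaluated at h t. Since h integrates to D = T m, its linear
   part integrates to zero. *)
pose L t := (cosh m - 1 - sinh m * m) + sinh m * h t.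
have iL : leb.-integrable `]a, c[ (EFin \o L).
  rewrite (_ : EFin \o L = (EFin \o cst (cosh m - 1 - sinh m * m)%R) \+
     (fun t => (sinh m)%:E * (EFin \o h) t))%E; last by apply/funext.
  exact: integrableD.
have intL : (\int[leb]_(t in `]a, c[) (L t)%:E)%E = (Astar T D)%:E.
  rewrite -[LHS]fineK; last exact: integrable_fin_num iL.
  congr EFin; rewrite -/(Rintegral leb `]a, c[ L) RintegralD//; last exact: icst.
  rewrite RintegralZl// hD Rintegral_cst// [X in fine X]lI /Astar -/T -/m /=.
  have -> : D = m * T by rewrite divfK// gt_eqF.
  ring.
(* The nonnegative gap above the tangent. In the case of equality its integral vanishes, so it is 0
   almost everywhere, and strictness of the tangent inequality gives h = m there. *)
pose P t := cosh (h t) - 1 - L t.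
have P0 t : 0 <= P t.
  by have := cosh_tangent_le m (h t); rewrite /P /L; lra.
have intP : (\int[leb]_(t in `]a, c[) (P t)%:E)%E = (J - (Astar T D)%:E)%E.
  rewrite -intL -integralB//.
have mP : measurable_fun `]a, c[ (EFin \o P).
  apply/measurable_EFinP.
  apply: measurable_funB.
    by apply/measurable_EFinP.
  by apply/measurable_EFinP; exact: measurable_int iL.
split.
  rewrite -sube_ge0// -intP; apply: integral_ge0 => t _.
  by rewrite lee_fin.
move=> JA.
have : (\int[leb]_(t in `]a, c[) `|(EFin \o P) t|)%E = 0%E.
  under eq_integral do rewrite gee0_abs ?lee_fin//.
  by rewrite intP JA subee.
move/(ae_eq_integral_abs leb mI mP).
apply: filterS => t Pt act.
have : (P t)%:E = 0%E :> \bar R by apply: Pt; rewrite /= in_itv.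
case=> Pt0; apply/eqP.
apply: contraTT isT => /(cosh_tangent_lt); move: Pt0; rewrite /P /L; lra.
Qed.

End jensen.

(** * Action of an admissible path *)

Section log_velocity.
Context {R : realType}.
Local Notation leb := (@lebesgue_measure R).
Implicit Types (a c x y t m : R) (f g : R -> R).

(** For x <= y, ln (y / x) <= y / x - 1 = (y - x) / x <= (y - x) / m. *)
Lemma ln_lipschitz m x y : 0 < m -> m <= x -> m <= y ->
  `|ln y - ln x| <= `|y - x| / m.
Proof.
move=> m0; wlog xy : x y / x <= y => [hw mx my|mx my].
  have [|/ltW yx] := leP x y; first by move=> xy; exact: hw.
  by rewrite distrC [X in _ <= X / _]distrC; exact: hw.
have x0 : 0 < x by exact: lt_le_trans mx.
have y0 : 0 < y by exact: lt_le_trans my.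
rewrite !ger0_norm ?subr_ge0 ?ler_ln ?posrE// -ln_div ?posrE//.
have -> : y / x = 1 + (y - x) / x by field; rewrite gt_eqF.
have yx0 : 0 <= (y - x) / x by rewrite divr_ge0 ?subr_ge0// ltW.
apply: (@le_trans _ _ ((y - x) / x)); first by apply: le_ln1Dx; lra.
by rewrite ler_wpM2l ?subr_ge0// lef_pV2.
Qed.

(** By compactness g has a positive minimum m on [a, c], and [ln] is 1/m-Lipschitz above m; hence
    the tolerance e * m is requested from g. *)
Lemma abs_continuous_on_ln a c g : a <= c -> abs_continuous_on a c g ->
  (forall t, a <= t <= c -> 0 < g t) -> abs_continuous_on a c (log_coordinate g).
Proof.
move=> ac gac g0.
have cg := abs_continuous_continuous (abs_continuous_clamp ac gac).
have [t0] := EVT_min ac (continuous_subspaceT cg).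
rewrite in_itv/= => act0 gmin.
set m := (g \o clamp a c) t0 in gmin.
have m0 : 0 < m by apply: g0; exact: clamp_itv.
have mg x : a <= x <= c -> m <= g x.
  by move=> axc; have := gmin x; rewrite in_itv axc => /(_ isT) /=;
    rewrite (clamp_id axc).
move=> e e0; have em0 : 0 < e * m by rewrite mulr_gt0.
have [d d0 H] := gac _ em0; exists d => // n u v uv tuv suv.
apply: (@le_lt_trans _ _ (\sum_(i < n) `|g (v i) - g (u i)| / m)).
  apply: ler_sum => i _; have [au uivi vc] := uv i.
  apply: ln_lipschitz => //; apply: mg; first by rewrite au (le_trans (ltW uivi)).
  by rewrite vc (le_trans au)// ltW.
by rewrite -mulr_suml ltr_pdivrMr//; exact: H.
Qed.

Lemma derive1_default f t : ~ derivable f t 1 -> derive1 f t = 0.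
Proof. by rewrite derive1E; exact: dvgP. Qed.

(* Both sides are 0 where g is not derivable. *)
Lemma log_velocityE g t : (\forall s \near t, 0 < g s) ->
  log_velocity g t = derive1 g t / g t.
Proof.
move=> g0; have gt0 := nbhs_singleton g0.
have [dg|ndg] := pselect (derivable g t 1).
  have dl := @is_derive1_comp _ (@ln R) g t _ _ (is_derive1_ln gt0) (derivableP dg).
  rewrite /log_velocity !derive1E mulrC; exact: (@derive_val _ _ _ _ _ _ _ dl).
rewrite (derive1_default ndg) mul0r /log_velocity derive1_default// => dl.
(* Near t, g is the exponential of its log-coordinate, so it would inherit derivability from it. *)
apply: ndg; apply: (@near_eq_derivable _ _ _ (expR \o log_coordinate g)).
  by near=> s; rewrite /= /log_coordinate lnK// posrE; near: s.
by apply: (@ex_derive _ _ _ _ _ _ _ (is_derive1_comp (is_derive_expR _) (derivableP dl))).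
Unshelve. all: by end_near. Qed.

Lemma near_itvoo a c x : a < x < c -> \forall s \near x, a < s < c.
Proof.
move=> axc; have := @near_in_itvoo R a c x.
rewrite in_itv/= => /(_ axc); apply: filterS => s; by rewrite in_itv.
Qed.

(** Trades the pointwise log-velocity for an integrable density. The two agree almost everywhere on
    ]a, c[, and the endpoints are null, so the action is the same. *)
Lemma log_velocity_density a c g : a < c -> admissible a c g ->
  exists h : R -> R, [/\ leb.-integrable setT (EFin \o h),
    forall x, a <= x <= c -> ln (g x) - ln (g a) = \int[leb]_(t in `]a, x]) h t &
    kinetic_action a c g =
      (\int[leb]_(t in `]a, c[) (cosh (h t) - 1)%:E)%E].
Proof.
move=> ac [gac g0 g2]; have lac := ltW ac.
have mI : measurable (`]a, c[%classic : set (measurableTypeR R)) by [].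
have Fac := abs_continuous_clamp lac (abs_continuous_on_ln lac gac g0).
have [h [ih hE ae_h]] := abs_continuous_FTC lac Fac.
have g0n x : a < x < c -> \forall s \near x, 0 < g s.
  move=> /near_itvoo; apply: filterS => s /andP[as_ sc].
  by apply: g0; rewrite !ltW.
have cg := abs_continuous_continuous (abs_continuous_clamp lac gac).
have mgV : measurable_fun `]a, c[ (fun x => (g (clamp a c x))^-1).
  apply: measurable_funTS; apply: continuous_measurable_fun => x.
  apply: (@continuousV _ _ (g \o clamp a c)); last exact: cg.
  by rewrite gt_eqF// g0//; exact: clamp_itv.
have mdg : measurable_fun `]a, c[ (derive1 g \_ `[a, c]).
  by apply: measurable_funTS; move: g2; rewrite inE => /andP[]; rewrite inE.
(* The log-velocity is g' / g, where measurability of g' comes from membership in L^2. *)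
have mv : measurable_fun `]a, c[ (log_velocity g).
  apply: (@eq_measurable_fun _ _ _ _ _
      (fun x => (derive1 g \_ `[a, c]) x * (g (clamp a c x))^-1)).
    move=> x; rewrite inE/= in_itv/= => axc.
    have axc' : a <= x <= c by case/andP: axc => /ltW-> /ltW->.
    by rewrite (log_velocityE (g0n _ axc)) /restrict mem_set ?clamp_id//= in_itv.
  exact: measurable_funM.
have mh : measurable_fun `]a, c[ h.
  by apply: measurable_funTS; apply/measurable_EFinP; exact: measurable_int ih.
exists h; split => //.
  by move=> x axc; rewrite -hE//= !clamp_id// ?lexx ?lac.
rewrite /kinetic_action integral_itv_bndoo; last exact: measurable_coshB1.
apply: ae_eq_integral => //; [exact: measurable_coshB1|exact: measurable_coshB1|].
move: ae_h; apply: filterS; first exact: (ae_filter_ringOfSetsType leb).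
move=> x /= H; rewrite in_itv/= => axc.
have [_ <-] := H axc; congr (cosh _ - 1)%:E.
rewrite /log_velocity !derive1E; apply: near_eq_derive.
near=> s; rewrite /= clamp_id//.
have /andP[/ltW-> /ltW->//] : a < s < c by near: s; exact: near_itvoo.
Unshelve. all: by end_near. Qed.

(** Jensen's inequality applied to the density. Equality makes the density almost everywhere
    constant, and integrating it from a to x shows that ln g is affine. *)
Lemma kinetic_action_ge a c g : a < c -> admissible a c g ->
  ((Astar (c - a) (ln (g c) - ln (g a)))%:E <= kinetic_action a c g)%E /\
  (kinetic_action a c g = (Astar (c - a) (ln (g c) - ln (g a)))%:E ->
   forall x, a <= x <= c -> g x = uniform_path a c (g a) (g c) x).
Proof.
move=> ac ag; have [h [ih hE ->]] := log_velocity_density ac ag.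
have iho x : leb.-integrable `]a, x[ (EFin \o h) by exact: integrableS ih.
have hEo x : a <= x <= c -> \int[leb]_(t in `]a, x[) h t = ln (g x) - ln (g a).
  by move=> axc; rewrite hE// -Rintegral_itv_bndo_bndc.
have hc : \int[leb]_(t in `]a, c[) h t = ln (g c) - ln (g a).
  by rewrite hEo// lexx ltW.
have [JA eqJ] := cosh_jensen ac (iho c) hc.
split=> // /eqJ {JA eqJ} ae_h x axc.
have [_ g0 _] := ag; have gx0 := g0 x axc.
have := hEo x axc; set D := ln (g c) - ln (g a).
rewrite /Rintegral (@ae_eq_integral _ _ _ leb _ (cst (D / (c - a))%:E))//; last 2 first.
- exact: measurable_int (iho x).
- move: ae_h; apply: filterS; first exact: (ae_filter_ringOfSetsType leb).
  move=> t /= H; rewrite in_itv/= => /andP[at_ tx].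
  by rewrite H// at_ (lt_le_trans tx)//; case/andP: axc.
(* The point x = a is treated apart, since the measure of ]a, x[ is computed for a < x. *)
move: axc => /andP[]; rewrite le_eqVlt => /predU1P[<-{gx0} _ _|ax xc].
  by rewrite /uniform_path subrr mul0r mul0r addr0 lnK// posrE g0// lexx ltW.
rewrite integral_cst// [X in (_ * X)%E]lebesgue_itvoo//= => gxE.
apply: (@ln_inj R); rewrite ?posrE ?expR_gt0//.
rewrite /uniform_path expRK -[LHS](subrK (ln (g a))) -gxE -/D.
by field; rewrite subr_eq0 gt_eqF.
Qed.

End log_velocity.

(** * Concatenation of uniform-log-velocity paths *)

Section concatenation.
Context {R : realType}.
Local Notation leb := (@lebesgue_measure R).
Implicit Types (a b c x y t K : R) (f g : R -> R).

Lemma lipschitz_abs_continuous_on a c f K : 0 <= K ->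
  (forall u v, a <= u -> u <= v -> v <= c -> `|f v - f u| <= K * (v - u)) ->
  abs_continuous_on a c f.
Proof.
move=> K0 fK e e0; have K10 : 0 < K + 1 by lra.
exists (e / (K + 1)); first by rewrite divr_gt0.
move=> n u v uv _; rewrite ltr_pdivlMr// => /(le_lt_trans _); apply.
rewrite mulr_suml; apply: ler_sum => i _; have [au uivi vc] := uv i.
apply: le_trans (fK _ _ au (ltW uivi) vc) _.
rewrite mulrC ler_wpM2l ?subr_ge0 ?(ltW uivi)//; lra.
Qed.

(** The value at b is arbitrary, as suits derivatives of a concatenation, which may have a corner
    there. *)
Lemma measurable_fun_itv_glue a b c f : a < b < c ->
  measurable_fun `[a, b[ f -> measurable_fun `]b, c] f ->
  measurable_fun `[a, c] f.
Proof.
move=> /andP[ab bc] fab fbc.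
rewrite (@itv_bndbnd_setU _ _ _ (BRight b)) ?bnd_simp ?(ltW ab) ?(ltW bc)//.
apply/measurable_funU => //; split => //.
rewrite -(@setUitv1 _ _ _ _ true) ?bnd_simp ?(ltW ab)//.
by apply/measurable_funU => //; split => //; exact: measurable_fun_set1.
Qed.

Lemma bounded_restrict_Lfun2 a c f K : a <= c -> measurable_fun `[a, c] f ->
  (forall t, a <= t <= c -> `|f t| <= K) -> (f \_ `[a, c]) \in Lfun leb 2%:E.
Proof.
move=> ac mf fK.
have K0 : 0 <= K by apply: le_trans (fK a _); rewrite ?lexx ?ac.
have mI : measurable (`[a, c]%classic : set (measurableTypeR R)) by [].
have mr : measurable_fun setT (f \_ `[a, c]).
  exact: (measurable_restrictT _ mI).1 mf.
rewrite inE; apply/andP; split; rewrite inE//=.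
rewrite /finite_norm unlock /=; apply: poweR_lty.
apply: (@le_lt_trans _ _
    (\int[leb]_x ((fun=> (K ^+ 2)%:E) \_ `[a, c]) x)%E); last first.
  rewrite -integral_mkcond integral_cst//= [X in (_ * X)%E]lebesgue_measure_itv/=.
  by rewrite lte_fin; case: ifP => _; rewrite ?mule0 ?ltry// -EFinD -EFinM ltry.
apply: ge0_le_integral => //.
- apply/measurable_EFinP; apply: (measurableT_comp (measurable_powR _)).
  exact: measurableT_comp.
- by apply/(measurable_restrictT _ mI); exact: measurable_cst.
- move=> t _; rewrite !patchE; case: ifPn => [|_].
    rewrite inE/= in_itv/= => act.
    rewrite lee_fin powR_mulrn//; apply: lerXn2r; rewrite ?nnegrE//; exact: fK.
  by rewrite normr0 /= powR0// pnatr_eq0.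
Qed.

Lemma uniform_pathl a b x y : 0 < x -> uniform_path a b x y a = x.
Proof. by move=> x0; rewrite /uniform_path subrr !mul0r addr0 lnK. Qed.

Lemma uniform_pathr a b x y : a < b -> 0 < y -> uniform_path a b x y b = y.
Proof.
move=> ab y0; rewrite /uniform_path divff ?subr_eq0 ?gt_eqF// mul1r.
by rewrite addrC subrK lnK.
Qed.

Definition log_slope a b x y := (ln y - ln x) / (b - a).

Lemma is_derive_uniform_path a b x y t :
  is_derive t 1 (uniform_path a b x y)
    (uniform_path a b x y t * log_slope a b x y).
Proof.
pose l s := ln x + (s - a) / (b - a) * (ln y - ln x).
have dl : is_derive t 1 l (log_slope a b x y).
  have -> : l = (fun s => (ln x - a * log_slope a b x y) + log_slope a b x y * s).
    apply/funext => s; rewrite /l /log_slope.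
    by set i := (b - a)^-1; ring.
  by apply: is_derive_eq; rewrite add0r mul1r /GRing.scale /= mulr1.
exact: (@is_derive1_comp _ expR l t _ _ (is_derive_expR _) dl).
Qed.

Lemma derive1_uniform_path a b x y t :
  derive1 (uniform_path a b x y) t = uniform_path a b x y t * log_slope a b x y.
Proof.
rewrite derive1E.
exact: (@derive_val _ _ _ _ _ _ _ (is_derive_uniform_path a b x y t)).
Qed.

Lemma continuous_uniform_path a b x y : continuous (uniform_path a b x y).
Proof.
move=> t; apply/differentiable_continuous/derivable1_diffP.
by have [] := is_derive_uniform_path a b x y t.
Qed.

Lemma log_velocity_uniform_path a b x y t :
  log_velocity (uniform_path a b x y) t = log_slope a b x y.
Proof.
have g0 : \forall s \near t, 0 < uniform_path a b x y s.
  by near=> s; exact: expR_gt0.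
rewrite (log_velocityE g0) derive1_uniform_path mulrC mulKf// gt_eqF//.
exact: expR_gt0.
Unshelve. all: by end_near. Qed.

Lemma uniform_path_le a b x y t : a < b -> a <= t <= b ->
  uniform_path a b x y t <= expR (`|ln x| + `|ln y - ln x|).
Proof.
move=> ab /andP[at_ tb]; rewrite ler_expR lerD ?ler_norm//.
apply: le_trans (ler_norm _) _; rewrite normrM ger0_norm; last first.
  by rewrite divr_ge0// subr_ge0// ltW.
by rewrite ler_piMl// ler_pdivrMr ?subr_gt0// mul1r lerD2r.
Qed.

Lemma uniform_path_lipschitz a b x y : a < b ->
  exists2 K, 0 <= K & forall u v, a <= u -> u <= v -> v <= b ->
    `|uniform_path a b x y v - uniform_path a b x y u| <= K * (v - u).
Proof.
move=> ab; pose M := expR (`|ln x| + `|ln y - ln x|).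
exists (M * `|log_slope a b x y|); first by rewrite mulr_ge0// expR_ge0.
move=> u v au; rewrite le_eqVlt => /predU1P[->|uv] vb.
  by rewrite !subrr normr0 mulr0.
have [||r] := @MVT _ (uniform_path a b x y)
  (fun t => uniform_path a b x y t * log_slope a b x y) u v uv.
- by move=> t _; exact: is_derive_uniform_path.
- by apply: continuous_subspaceT; exact: continuous_uniform_path.
rewrite in_itv/= => /andP[ur rv] ->.
rewrite normrM (gtr0_norm (_ : 0 < v - u)) ?subr_gt0//.
rewrite ler_wpM2r ?subr_ge0 ?(ltW uv)// normrM ler_wpM2r//.
rewrite gtr0_norm ?expR_gt0//; apply: uniform_path_le => //.
by apply/andP; split; lra.
Qed.

Lemma near_derive1 f g t : (\forall s \near t, f s = g s) ->
  derive1 f t = derive1 g t.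
Proof. by move=> fg; rewrite !derive1E; exact: near_eq_derive. Qed.

Variables (a b c xa y xc : R).
Hypotheses (abc : a < b < c) (xa0 : 0 < xa) (y0 : 0 < y) (xc0 : 0 < xc).

Let g1 := uniform_path a b xa y.
Let g2 := uniform_path b c y xc.
Let g := concat_path b g1 g2.
Let ab : a < b. Proof. by case/andP: abc. Qed.
Let bc : b < c. Proof. by case/andP: abc. Qed.

Let near_g1 t : t < b -> \forall s \near t, g s = g1 s.
Proof.
by move=> tb; near=> s; rewrite /g /concat_path ltW//; near: s; exact: lt_nbhsl.
Unshelve. all: by end_near. Qed.

Let near_g2 t : b < t -> \forall s \near t, g s = g2 s.
Proof.
move=> bt; near=> s; rewrite /g /concat_path leNgt ifF//; apply/negbF.
by near: s; exact: lt_nbhsr.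
Unshelve. all: by end_near. Qed.

Let g_gt0 t : 0 < g t.
Proof. by rewrite /g /concat_path; case: ifP => _; exact: expR_gt0. Qed.

Let near_g_gt0 t : \forall s \near t, 0 < g s.
Proof.
by near=> s; exact: g_gt0.
Unshelve. all: by end_near. Qed.

Let derive1_g1 t : t < b -> derive1 g t = g1 t * log_slope a b xa y.
Proof. by move=> /near_g1/near_derive1 ->; exact: derive1_uniform_path. Qed.

Let derive1_g2 t : b < t -> derive1 g t = g2 t * log_slope b c y xc.
Proof. by move=> /near_g2/near_derive1 ->; exact: derive1_uniform_path. Qed.

Let gE1 t : t <= b -> g t = g1 t.
Proof. by rewrite /g /concat_path => ->. Qed.

Let gE2 t : b <= t -> g t = g2 t.
Proof.
rewrite /g /concat_path le_eqVlt => /predU1P[<-|bt]; last by rewrite leNgt bt.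
by rewrite lexx /g1 /g2 uniform_pathl// uniform_pathr.
Qed.

Let log_velocity_g1 t : t < b -> log_velocity g t = log_slope a b xa y.
Proof.
move=> tb; rewrite (log_velocityE (near_g_gt0 t)) derive1_g1// gE1 ?ltW//.
rewrite mulrC mulKf// gt_eqF//.
exact: expR_gt0.
Qed.

Let log_velocity_g2 t : b < t -> log_velocity g t = log_slope b c y xc.
Proof.
move=> bt; rewrite (log_velocityE (near_g_gt0 t)) derive1_g2// gE2 ?ltW//.
rewrite mulrC mulKf// gt_eqF//.
exact: expR_gt0.
Qed.

Lemma concat_path_admissible : admissible a c g.
Proof.
split.
- have [K1 K10 L1] := uniform_path_lipschitz xa y ab.
  have [K2 K20 L2] := uniform_path_lipschitz y xc bc.
  (* The sum dominates both Lipschitz constants; an interval straddling b is split at b. *)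
  apply: (@lipschitz_abs_continuous_on _ _ _ (K1 + K2)); first exact: addr_ge0.
  move=> u v au uv vc; have [vb|bv] := leP v b.
    rewrite !gE1//; last exact: le_trans vb.
    apply: le_trans (L1 _ _ au uv vb) _.
    by rewrite ler_wpM2r ?subr_ge0// lerDl.
  have [bu|ub] := leP b u.
    rewrite !gE2 ?(ltW bv)//; apply: le_trans (L2 _ _ bu uv vc) _.
    by rewrite ler_wpM2r ?subr_ge0// lerDr.
  have -> : g v - g u = (g2 v - g2 b) + (g1 b - g1 u).
    by rewrite gE2 ?(ltW bv)// (gE1 (ltW ub)) -(gE1 (lexx b)) -(gE2 (lexx b)); ring.
  apply: le_trans (ler_normD _ _) _.
  apply: le_trans (lerD (L2 _ _ (lexx b) (ltW bv) vc) (L1 _ _ au (ltW ub) (lexx b))) _.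
  have := mulr_ge0 K10 (_ : 0 <= v - b); rewrite subr_ge0 => /(_ (ltW bv)).
  have := mulr_ge0 K20 (_ : 0 <= b - u); rewrite subr_ge0 => /(_ (ltW ub)).
  by lra.
- by move=> t _; exact: g_gt0.
- pose M1 := expR (`|ln xa| + `|ln y - ln xa|) * `|log_slope a b xa y|.
  pose M2 := expR (`|ln y| + `|ln xc - ln y|) * `|log_slope b c y xc|.
  have M10 : 0 <= M1 by rewrite mulr_ge0// expR_ge0.
  have M20 : 0 <= M2 by rewrite mulr_ge0// expR_ge0.
  (* M1 and M2 bound the derivative on either side of b; the last term covers b itself, whatever
     value [derive1] takes there. *)
  apply: (@bounded_restrict_Lfun2 _ _ _ (M1 + M2 + `|derive1 g b|)).
  + by rewrite ltW// (lt_trans ab).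
  + apply: (measurable_fun_itv_glue abc).
      apply: (@eq_measurable_fun _ _ _ _ _ (fun t => g1 t * log_slope a b xa y)).
        by move=> t; rewrite inE/= in_itv/= => /andP[_ /derive1_g1].
      apply: measurable_funM => //; apply: measurable_funTS.
      by apply: continuous_measurable_fun; exact: continuous_uniform_path.
    apply: (@eq_measurable_fun _ _ _ _ _ (fun t => g2 t * log_slope b c y xc)).
      by move=> t; rewrite inE/= in_itv/= => /andP[/derive1_g2].
    apply: measurable_funM => //; apply: measurable_funTS.
    by apply: continuous_measurable_fun; exact: continuous_uniform_path.
  + move=> t /andP[at_ tc]; have [tb|bt|->] := ltgtP t b.
    * rewrite derive1_g1// normrM -addrA ler_wpDr ?addr_ge0//.
      rewrite ler_wpM2r// gtr0_norm ?expR_gt0//.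
      by apply: uniform_path_le => //; rewrite at_ ltW.
    * rewrite derive1_g2// normrM [M1 + M2]addrC -addrA ler_wpDr ?addr_ge0//.
      rewrite ler_wpM2r// gtr0_norm ?expR_gt0//.
      by apply: uniform_path_le => //; rewrite tc ltW.
    * by rewrite lerDr addr_ge0.
Qed.

Lemma concat_path_action : kinetic_action a c g =
  (Astar (b - a) (ln y - ln xa) + Astar (c - b) (ln xc - ln y))%:E.
Proof.
pose F t := cosh (log_velocity g t) - 1.
have F1 t : t < b -> F t = cosh (log_slope a b xa y) - 1.
  by move=> tb; rewrite /F log_velocity_g1.
have F2 t : b < t -> F t = cosh (log_slope b c y xc) - 1.
  by move=> bt; rewrite /F log_velocity_g2.
have mF1 : measurable_fun `[a, b[ F.
  apply: (@eq_measurable_fun _ _ _ _ _ (cst (cosh (log_slope a b xa y) - 1))) => //.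
  by move=> t; rewrite inE/= in_itv/= => /andP[_ /F1].
have mF2 : measurable_fun `]b, c] F.
  apply: (@eq_measurable_fun _ _ _ _ _ (cst (cosh (log_slope b c y xc) - 1))) => //.
  by move=> t; rewrite inE/= in_itv/= => /andP[/F2].
have mF := measurable_fun_itv_glue abc mF1 mF2.
(* Endpoints are null, so the integrand has to be known only inside each piece, and one computation
   covers both [a, b] and ]b, c]. *)
have intE u v k : u < v -> (forall t, u < t < v -> F t = cosh (k / (v - u)) - 1) ->
    measurable_fun `]u, v[ F ->
    forall b0 b1 : bool,
    (\int[leb]_(t in [set` Interval (BSide b0 u) (BSide b1 v)]) (F t)%:E)%E =
    (Astar (v - u) k)%:E.
  move=> uv FE mFuv b0 b1; rewrite integral_itv_bndoo; last exact/measurable_EFinP.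
  under eq_integral.
    move=> t; rewrite inE/= in_itv/= => /FE ->; over.
  by rewrite integral_cst//= [X in (_ * X)%E]lebesgue_itvoo// -EFinM mulrC.
have itvE : `[a, c]%classic = `[a, b] `|` `]b, c] :> set R.
  by rewrite -itv_bndbnd_setU// ?bnd_simp ltW.
rewrite /kinetic_action -/F itvE ge0_integral_setU//=.
- rewrite EFinD; congr (_ + _)%E.
    apply: intE => //; first by move=> t /andP[_ /F1].
    by apply: measurable_funS mF1 => //; exact: subset_itv_oo_co.
  apply: intE => //; first by move=> t /andP[/F2].
  by apply: measurable_funS mF2 => //; exact: subset_itv_oo_oc.
- by rewrite -itvE; apply/measurable_EFinP.
- by move=> t _; rewrite lee_fin subr_ge0 cosh_ge1.
- apply/disj_setPS => t [] /=; rewrite !in_itv/= => /andP[_ tb] /andP[bt _].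
  by have := le_lt_trans tb bt; rewrite ltxx.
Qed.

Lemma concat_path_kinetic : kinetic_paths a c xa xc g.
Proof.
split; first split.
- exact: concat_path_admissible.
- by rewrite concat_path_action ltry.
- by rewrite gE1 ?(ltW ab)// /g1 uniform_pathl.
- by rewrite gE2 ?(ltW bc)// /g2 uniform_pathr.
Qed.

End concatenation.

(** * Minimality *)

(** Lets the facts on concatenations apply to a single uniform path, cut at one of its own
    points. *)
Lemma uniform_path_split {R : realType} (a b c xa xc : R) : a < b < c ->
  let g := uniform_path a c xa xc in
  concat_path b (uniform_path a b xa (g b)) (uniform_path b c (g b) xc) = g.
Proof.
move=> /andP[ab bc] g.
have ba0 : b - a != 0 by rewrite subr_eq0 gt_eqF.
have cb0 : c - b != 0 by rewrite subr_eq0 gt_eqF.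
have ca0 : c - a != 0 by rewrite subr_eq0 gt_eqF// (lt_trans ab).
apply/funext => t; rewrite /concat_path.
case: ifP => _; rewrite /g /uniform_path expRK; congr expR; field.
  by rewrite ba0 ca0.
by rewrite cb0 ca0.
Qed.

Lemma uniform_path_kinetic {R : realType} (a c xa xc : R) :
  a < c -> 0 < xa -> 0 < xc ->
  let g := uniform_path a c xa xc in
  kinetic_paths a c xa xc g /\
  kinetic_action a c g = (Astar (c - a) (ln xc - ln xa))%:E.
Proof.
(* Cut at the midpoint, each half carries half of the time and half of the log-increment, so the two
   actions are equal. *)
move=> ac xa0 xc0 g; pose b := (a + c) / 2.
have abc : a < b < c by rewrite /b; apply/andP; split; lra.
have gb0 : 0 < g b by exact: expR_gt0.
have gE := uniform_path_split xa xc abc; rewrite /= -/g in gE.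
split; first by rewrite -[X in kinetic_paths _ _ _ _ X]gE; exact: concat_path_kinetic.
rewrite -[X in kinetic_action _ _ X]gE concat_path_action//; congr EFin.
rewrite /g /uniform_path expRK /Astar /b.
have ca0 : c - a != 0 by rewrite subr_eq0 gt_eqF.
set D := ln xc - ln xa; set r := _ / _ * D.
have r2 : r = D / 2 by rewrite /r; field.
have -> : ln xa + r - ln xa = D / 2 by rewrite r2; ring.
have -> : ln xc - (ln xa + r) = D / 2 by rewrite r2 /D; field.
have -> : (a + c) / 2 - a = (c - a) / 2 by field.
have -> : c - (a + c) / 2 = (c - a) / 2 by field.
have -> : D / 2 / ((c - a) / 2) = D / (c - a) by field.
by field.
Qed.
Theorem corollary4p17 (R : realType) :
  (forall T1 T2 D1 D2 : R, 0 < T1 -> 0 < T2 ->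
     Astar (T1 + T2) (D1 + D2) <= Astar T1 D1 + Astar T2 D2 /\
     (Astar (T1 + T2) (D1 + D2) = Astar T1 D1 + Astar T2 D2 <->
        D1 / T1 = D2 / T2))
  /\
  (forall a c xa xc : R, a < c -> 0 < xa -> 0 < xc ->
     let gstar := uniform_path a c xa xc in
     [/\ global_minimizer (kinetic_action a c) (kinetic_paths a c xa xc) gstar,
         (forall g : R -> R,
            global_minimizer (kinetic_action a c) (kinetic_paths a c xa xc) g ->
            forall t : R, a <= t <= c -> g t = gstar t) &
         (forall b y : R, a < b < c -> 0 < y ->
            let g1 := uniform_path a b xa y in
            let g2 := uniform_path b c y xc in
            let g := concat_path b g1 g2 in
            [/\ kinetic_paths a c xa xc g,
                (kinetic_action a c gstar <= kinetic_action a c g)%E &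
                (kinetic_action a c g = kinetic_action a c gstar <->
                 forall s t : R, a < s < b -> b < t < c ->
                   log_velocity g1 s = log_velocity g2 t)])]).
Proof.
split=> [T1 T2 D1 D2 T10 T20|a c xa xc ac xa0 xc0 gstar].
  have AA := Astar_subadditive D1 D2 T10 T20; split; first by rewrite AA.
  by split=> /eqP e; apply/eqP; [rewrite -AA|rewrite AA].
have [kgs Ags] := uniform_path_kinetic ac xa0 xc0.
have lower g : kinetic_paths a c xa xc g ->
    (kinetic_action a c gstar <= kinetic_action a c g)%E.
  by move=> [[ag _] ga gc]; have [+ _] := kinetic_action_ge ac ag; rewrite ga gc -Ags.
split.
- by split.
- move=> g [[[ag kg] ga gc] gmin] t act.
  have [_ gE] := kinetic_action_ge ac ag; rewrite ga gc in gE.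
  (* Two minimizers have the same action, so g attains the lower bound, and the equality case
     identifies it with [gstar] on [a, c]. *)
  apply: (gE _ t act); apply: le_anti; apply/andP; rewrite -Ags; split.
    exact: gmin.
  by apply: lower; split.
move=> b y abc y0 g1 g2 g.
have kg : kinetic_paths a c xa xc g by exact: concat_path_kinetic.
split; [exact: kg|exact: lower|].
have /andP[ab bc] := abc.
have T10 : 0 < b - a by rewrite subr_gt0.
have T20 : 0 < c - b by rewrite subr_gt0.
have Ag : kinetic_action a c g =
    (Astar (b - a) (ln y - ln xa) + Astar (c - b) (ln xc - ln y))%:E.
  exact: concat_path_action.
rewrite Ag [X in _ = X <-> _]Ags.
have AA := Astar_subadditive (ln y - ln xa) (ln xc - ln y) T10 T20.
rewrite [X in Astar X _](_ : _ = c - a) in AA; last by ring.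
rewrite [X in Astar _ X](_ : _ = ln xc - ln xa) in AA; last by ring.
split=> [[e] s t _ _|vv].
  by rewrite !log_velocity_uniform_path; apply/eqP; rewrite -AA e.
congr EFin; apply/esym/eqP; rewrite AA; apply/eqP.
(* Log-velocities of uniform paths are constant, so one sample time in each piece suffices;
   midpoints are taken. *)
have := vv ((a + b) / 2) ((b + c) / 2).
rewrite !log_velocity_uniform_path; apply; apply/andP; split; lra.
Qed.
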